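(* Suppose there is a $\mathcal K$-Lusin set of cardinality $\mathfrak d$. Then for any cardinal $\kappa$, there is an FLS space of finite scattered height with cardinality $\kappa$ if and only if $\kappa\le\mathfrak d$.
   Context: For $f,g\in\omega^\omega$, $f\le^* g$ means $f(n)\le g(n)$ for all but finitely many $n$. $\mathfrak d$ is the least cardinality of a subset $D\subseteq\omega^\omega$ such that for every $f\in\omega^\omega$ there is $g\in D$ with $f\le^* g$. $\omega^\omega$ carries the product topology ($\omega$ discrete). A $\mathcal K$-Lusin set is a set $L\subseteq\omega^\omega$ such that $K\cap L$ is countable for every compact $K\subseteq\omega^\omega$. All spaces are Hausdorff topological spaces. For a space $X$, $X^{(1)}$ is the set of non-isolated points of $X$; $X^{(0)}=X$ and $X^{(\alpha)}=\bigcap_{\xi<\alpha}(X^{(\xi)})^{(1)}$ for ordinals $\alpha>0$. $X$ is scattered if every nonempty subspace has an isolated point; the scattered height of a scattered space $X$ is the smallest ordinal $\alpha$ with $X^{(\alpha)}=\emptyset$. An FLS space is a first-countable Lindelöf scattered (Hausdorff) space. *)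

(* Defs.v *)
From HB Require Import structures.
From mathcomp Require Import all_boot.
From mathcomp Require Import all_classical.
From mathcomp Require Import topology.

Set Implicit Arguments.
Unset Strict Implicit.
Unset Printing Implicit Defensive.

Local Open Scope classical_set_scope.
Local Open Scope card_scope.

Definition baire : Type := prod_topology (fun _ : nat => nat).

HB.instance Definition _ := Nbhs.on baire.
HB.instance Definition _ := Topological.on baire.

Definition le_star (f g : baire) : Prop := \forall n \near \oo, f n <= g n.

Definition dominating (D : set baire) : Prop :=
  forall f : baire, exists2 g, D g & le_star f g.

Lemma least_card_exists (T : Type) (fam : set (set T)) :
  fam !=set0 -> exists2 D, fam D & forall E, fam E -> D #<= E.
Proof.
move=> [E0 famE0].
(* Zorn on the sets of choice functions all of whose coordinate projections
   are injective *)
pose P (F : set (set T -> T)) := forall E, fam E ->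
  (forall f, F f -> E (f E)) /\
  (forall f g, F f -> F g -> f E = g E -> f = g).
have [|F [PF maxF]] := @Zorn_bigcup _ P.
  move=> C CP totC E famE; split.
    by move=> f [A CA Af]; have [+ _] := CP _ CA _ famE; apply.
  move=> f g [A CA Af] [B CB Bg].
  have [AB|BA] := totC _ _ CA CB.
    by have [_ +] := CP _ CB _ famE; apply=> //; exact: AB.
  by have [_ +] := CP _ CA _ famE; apply=> //; exact: BA.
have [E famE surjE] : exists2 E, fam E & forall x, E x -> exists2 f, F f & f E = x.
  apply: contrapT => noE.
  have hE E : fam E -> exists x, E x /\ forall f, F f -> f E <> x.
    move=> famE; apply: contrapT => nx; apply: noE; exists E => // x Ex.
    apply: contrapT => nf; apply: nx; exists x; split=> // f Ff fx.
    by apply: nf; exists f.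
  have [x0 _] := hE _ famE0.
  have /choice[h hP] : forall E, exists x, fam E ->
      E x /\ forall f, F f -> f E <> x.
    move=> E; have [/hE[x Hx]|nE] := pselect (fam E); first by exists x.
    by exists x0.
  have Fh : ~ F h by move=> Fh; have [_ /(_ h Fh)] := hP _ famE0; apply.
  apply: (maxF (F `|` [set h])).
    split; first by move=> f Ff; left.
    by move=> sub; apply: Fh; apply: sub; right.
  move=> E famE; have [PE PI] := PF _ famE; have [Eh Nh] := hP _ famE; split.
    by move=> f [Ff|->//]; exact: PE.
  move=> f g [Ff|->] [Fg|->] // fg; first exact: PI.
    by case: (Nh f Ff).
  by case: (Nh g Fg).
exists E => // E' famE'.
have /choice[s sP] : forall x, exists f, E x -> F f /\ f E = x.
  move=> x; have [/surjE[f Ff fx]|nEx] := pselect (E x); first by exists f.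
  by exists (fun _ => x).
have : exists2 f : T -> T, set_fun E E' f & set_inj E f.
  exists (fun x => s x E').
    by move=> x /sP[Fx _]; exact: (PF _ famE').1.
  move=> x y /set_mem Ex /set_mem Ey sxy.
  have [Fx <-] := sP _ Ex; have [Fy <-] := sP _ Ey.
  by rewrite ((PF _ famE').2 _ _ Fx Fy sxy).
by move=> /injfunPex[g]; exact: inj_card_le g.
Qed.

Lemma dominating_number_exists :
  exists D, dominating D /\ forall E, dominating E -> D #<= E.
Proof.
have [|D domD leD] := @least_card_exists baire dominating; last by exists D.
by exists [set: baire] => f; exists f => //; exact: nearW.
Qed.

(* The dominating number, represented by a dominating family realizing it:
   "A has cardinality d" reads A #= dfrak. *)
Definition dfrak : set baire := projT1 (cid dominating_number_exists).

Lemma dfrakP :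
  dominating dfrak /\ forall E, dominating E -> dfrak #<= E.
Proof. exact: projT2 (cid dominating_number_exists). Qed.

Definition K_Lusin (L : set baire) : Prop :=
  forall K : set baire, compact K -> countable (K `&` L).

Section Spaces.
Variable X : topologicalType.

Definition first_countable : Prop :=
  forall x : X, exists B : set (set X),
    [/\ countable B, B `<=` nbhs x &
        forall U, nbhs x U -> exists2 V, B V & V `<=` U].

Definition Lindelof : Prop :=
  forall C : set (set X), C `<=` open -> \bigcup_(U in C) U = [set: X] ->
    exists C' : set (set X),
      [/\ C' `<=` C, countable C' & \bigcup_(U in C') U = [set: X]].

Definition scattered : Prop :=
  forall A : set X, A !=set0 -> isolated A !=set0.

Definition derived (A : set X) : set X := A `\` isolated A.

(* Only finite ordinals are needed; see [iter_derivedE] for the transfinite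
   form of the recursion. *)
Definition iter_derived (n : nat) : set X := iter n derived [set: X].

Lemma iter_derivedE n :
  iter_derived n = \bigcap_(k in `I_n) derived (iter_derived k).
Proof.
apply/seteqP; split.
  elim: n => [|n IHn] x /= xn k //=; rewrite ltnS leq_eqVlt.
  by move=> /predU1P[->//|]; apply: IHn; case: xn.
case: n => [|n] x // /(_ n); apply; exact: ltnSn.
Qed.

Definition has_scattered_height (n : nat) : Prop :=
  iter_derived n = set0 /\ forall m, iter_derived m = set0 -> n <= m.

Definition FLS : Prop :=
  [/\ hausdorff_space X, first_countable, Lindelof & scattered].

End Spaces.

(* Main.v *)
From HB Require Import structures.
Require Import Defs.
From mathcomp Require Import all_boot.
From mathcomp Require Import all_classical.
From mathcomp Require Import topology.

(** Upper bound. Let [X] be first countable, Lindelof and Hausdorff, of finite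
    scattered height. Every derived set [A] of [X] has at most [dfrak] points
    and an outer base (open neighbourhoods, one inside each neighbourhood of
    [A]) of at most [dfrak] members; this climbs from [derived A] to [A],
    starting at the empty set. Indeed, if [U] is an open neighbourhood of
    [derived A], then [A `\` U] is closed and discrete, hence countable
    ([derived_nbhs_countable]). A countable set has an outer base of size
    [dfrak], because its neighbourhoods are prescribed by functions from [nat]
    to [nat], larger functions giving smaller neighbourhoods
    ([countable_small_character]). Adjoining such outer bases of the sets
    [A `\` U] to the members [U] of an outer base of [derived A] gives one of
    [A] ([small_character_derived]); and as each point of [isolated A] is left
    out by some such [U], these points are covered by [dfrak] countable sets
    ([card_isolated_le_dfrak]). The cardinal arithmetic rests on Hessenberg's
    theorem that an infinite set is as large as its square
    ([card_le_square]).

    Construction. Let [f] inject an uncountable [K], of size at most [dfrak],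
    into a K-Lusin set. Countably many points of [K] are made into names of the
    finite sequences of naturals, the nodes of the tree whose branches are the
    elements of the Baire space; the other points are isolated. A basic
    neighbourhood of a node [s] consists of [s] and of the isolated points [y]
    such that the branch [f y] passes through [s] and next takes a value at
    least [k]. Nodes are separated because a branch through a node [s] and a
    node [t] extending it must leave [s] along [t] ([tail_disjoint]). The
    space is Lindelof because the branches avoiding a neighbourhood of the set
    of nodes form a finitely branching tree, which lies in a compact set and so
    meets the K-Lusin set in a countable set ([Lindelof_node_space]). Deleting
    the isolated points leaves the discrete set of nodes, so the height is at
    most 2. *)

Set Implicit Arguments.
Unset Strict Implicit.
Unset Printing Implicit Defensive.

Local Open Scope classical_set_scope.
Local Open Scope card_scope.

(** * Cardinal arithmetic *)

Lemma card_le_inj (T U : Type) (u0 : U) (A : set T) (B : set U) :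
  A #<= B -> exists2 f : T -> U, set_fun A B f & set_inj A f.
Proof.
elim/Ppointed: U => U in u0 B *; first by case: (no u0).
by move=> /pcard_leP/injfunPex.
Qed.

Lemma inj_le_card (T U : Type) (A : set T) (B : set U) (f : T -> U) :
  set_fun A B f -> set_inj A f -> A #<= B.
Proof.
move=> fAB finj; have : exists2 g : T -> U, set_fun A B g & set_inj A g.
  by exists f.
by move=> /injfunPex[g]; exact: inj_card_le g.
Qed.

(** A least element of the family [{A, B}] decides. *)
Lemma card_le_total (T : Type) (A B : set T) : A #<= B \/ B #<= A.
Proof.
have [|D [->|->] leD] := @least_card_exists T [set A; B].
- by exists A; left.
- by left; apply: leD; right.
- by right; apply: leD; left.
Qed.

Lemma card_leX (T T' U U' : Type) (A : set T) (A' : set T') (B : set U)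
    (B' : set U') :
  A #<= A' -> B #<= B' -> A `*` B #<= A' `*` B'.
Proof.
have [->|/set0P[a0 Aa0]] := eqVneq A set0; first by rewrite set0X card_ge0.
have [->|/set0P[b0 Bb0]] := eqVneq B set0; first by rewrite setX0 card_ge0.
move=> leA leB.
have [a' _] : A' !=set0.
  by apply/set0P/negP=> /eqP A0; move: leA Aa0; rewrite A0 => /card_le0P->.
have [b' _] : B' !=set0.
  by apply/set0P/negP=> /eqP B0; move: leB Bb0; rewrite B0 => /card_le0P->.
have [f fA finj] := card_le_inj a' leA.
have [g gB ginj] := card_le_inj b' leB.
apply: (@inj_le_card _ _ _ _ (fun p => (f p.1, g p.2))).
  by move=> [a b] [/= /fA ? /gB ?]; split.
move=> [a b] [c d] /set_mem[/= Aa Bb] /set_mem[/= Ac Bd] [fac gbd].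
by congr pair; [apply: finj|apply: ginj]; rewrite ?inE.
Qed.

(** The points of the union are coded by an index and a position in the
    corresponding member, that is, by a pair of elements of [B]. *)
Lemma card_le_bigcup (I T U : Type) (B : set U) (D : set I) (F : I -> set T) :
  B `*` B #<= B -> D #<= B -> (forall i, D i -> F i #<= B) ->
  \bigcup_(i in D) F i #<= B.
Proof.
move=> BB DB FB.
have [->|/set0P[x0 [i0 Di0 Fx0]]] := eqVneq (\bigcup_(i in D) F i) set0.
  exact: card_ge0.
have [b0 _] : B !=set0.
  by apply/set0P/negP=> /eqP B0; move: DB Di0; rewrite B0 => /card_le0P->.
have [j jB jinj] := card_le_inj b0 DB.
have /choice[g gP] : forall i, exists g : T -> U,
    D i -> set_fun (F i) B g /\ set_inj (F i) g.
  move=> i; have [/FB/(card_le_inj b0)[g]|nD] := pselect (D i).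
    by exists g.
  by exists (fun=> b0).
have /choice[k kP] : forall x, exists i, (\bigcup_(i in D) F i) x ->
    D i /\ F i x.
  move=> x; have [[i Di Fx]|nD] := pselect ((\bigcup_(i in D) F i) x).
    by exists i.
  by exists i0.
apply: card_le_trans BB.
apply: (@inj_le_card _ _ _ _ (fun x => (j (k x), g (k x) x))).
  move=> x /kP[Dk Fk]; split=> /=; first exact: jB.
  exact: (gP _ Dk).1.
move=> x y /set_mem/kP[Dx Fx] /set_mem/kP[Dy Fy] [jxy].
have kxy : k x = k y by apply: jinj; rewrite ?inE.
by rewrite -kxy in Fy *; apply: (gP _ Dx).2; rewrite ?inE.
Qed.

Lemma countable_le_infinite (T U : Type) (A : set T) (B : set U) :
  countable A -> infinite_set B -> A #<= B.
Proof. by move=> cA /infiniteP; exact: card_le_trans. Qed.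

Lemma card_le_setU (T U : Type) (B : set U) (A A' : set T) :
  infinite_set B -> B `*` B #<= B -> A #<= B -> A' #<= B -> A `|` A' #<= B.
Proof.
move=> Binf BB AB A'B.
have -> : A `|` A' = \bigcup_b (if b then A else A').
  apply/seteqP; split=> x; first by case=> ?; [exists true|exists false].
  by case=> -[] _; [left|right].
apply: card_le_bigcup => //; last by case.
exact: countable_le_infinite.
Qed.

(** Hessenberg's theorem. A maximal pairing function, injecting [B `*` B] into
    an infinite [B `<=` A], exists by Zorn. If a copy [C] of [B] fitted in
    [A `\` B], the new pairs of [B `|` C], as numerous as [B], could be sent
    into [C], contradicting maximality; hence [A `\` B] is at most as large
    as [B], and so is [A]. *)
Theorem card_le_square (T : Type) (A : set T) :
  infinite_set A -> A `*` A #<= A.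
Proof.
move=> Ainf; have [x0 _] := infinite_setN0 Ainf.
pose good (p : set T * (T * T -> T)) := [/\ p.1 `<=` A, infinite_set p.1,
  set_fun (p.1 `*` p.1) p.1 p.2 & set_inj (p.1 `*` p.1) p.2].
pose R (p q : {p | good p}) := `[< (sval p).1 `<=` (sval q).1 /\
  forall z, ((sval p).1 `*` (sval p).1) z -> (sval p).2 z = (sval q).2 z >].
(* for the empty chain: a pairing function on a countable subset of A *)
have [t0 _] : exists t : {p | good p}, True.
  have /infiniteP/(card_le_inj x0)[e eA einj] := Ainf.
  have eN : [set: nat] #<= range e.
    apply: (@inj_le_card _ _ _ _ e) => //; exact: imageP.
  have Ne : countable (range e) by exact: card_image_le.
  have /(card_le_inj x0)[f fe finj] : range e `*` range e #<= range e.
    by apply: countable_le_infinite; [exact: countableX|exact/infiniteP].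
  suff g : good (range e, f) by exists (exist _ _ g).
  split=> //=; last exact/infiniteP.
  by move=> _ [n _ <-]; apply: eA.
have [||C totC|[[B f] goodB] Bmax] := @ZL_preorder _ t0 R.
- by move=> p; apply/asboolP; split.
- move=> r s t /asboolP[rs frs] /asboolP[st fst].
  apply/asboolP; split; first exact: subset_trans st.
  by move=> z rz; rewrite frs // fst //; case: rz => /rs ? /rs ?; split.
- have [->|/set0P[p0 Cp0]] := eqVneq C set0; first by exists t0.
  pose B := \bigcup_(p in C) (sval p).1.
  have wit z : (B `*` B) z -> exists2 p, C p & ((sval p).1 `*` (sval p).1) z.
    move=> [[p Cp pz] [q Cq qz]].
    have [/asboolP[pq _]|/asboolP[qp _]] := totC _ _ Cp Cq.
      by exists q => //; split=> //; exact: pq.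
    by exists p => //; split=> //; exact: qp.
  have /choice[h hP] : forall z, exists y, forall p, C p ->
      ((sval p).1 `*` (sval p).1) z -> (sval p).2 z = y.
    move=> z; have [/wit[p Cp pz]|nB] := pselect ((B `*` B) z); last first.
      by exists x0 => p Cp [? ?]; case: nB; split; exists p.
    exists ((sval p).2 z) => q Cq qz.
    have [/asboolP[_ pq]|/asboolP[_ qp]] := totC _ _ Cp Cq.
      by rewrite pq.
    by rewrite qp.
  have g : good (B, h).
    split=> /=.
    + by move=> x [p Cp]; case: (svalP p) => + _ _ _; apply.
    + apply: (@sub_infinite_set _ (sval p0).1); last by case: (svalP p0).
      by move=> x px; exists p0.
    + move=> z /wit[p Cp pz]; rewrite -(hP _ _ Cp pz); exists p => //.
      by case: (svalP p) => _ _ + _; apply.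
    + move=> y z /set_mem/wit[p Cp py] /set_mem/wit[q Cq qz].
      have [/asboolP[pq _]|/asboolP[qp _]] := totC _ _ Cp Cq.
        have qy : ((sval q).1 `*` (sval q).1) y.
          by case: py => /pq ? /pq ?; split.
        rewrite -(hP _ _ Cq qy) -(hP _ _ Cq qz).
        by case: (svalP q) => _ _ _; apply; rewrite inE.
      have pz : ((sval p).1 `*` (sval p).1) z.
        by case: qz => /qp ? /qp ?; split.
      rewrite -(hP _ _ Cp py) -(hP _ _ Cp pz).
      by case: (svalP p) => _ _ _; apply; rewrite inE.
  exists (exist _ _ g) => p Cp; apply/asboolP; split=> /=.
    by move=> x px; exists p.
  by move=> z pz; apply: hP.
have [/= BA Binf fB finj] := goodB.
have BB : B `*` B #<= B by exact: inj_le_card finj.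
have [leB|leC] := card_le_total B (A `\` B); last first.
  have AB : A #<= B.
    rewrite -(setDUK BA); apply: card_le_setU => //; exact: card_lexx.
  apply: card_le_trans (card_leX AB AB) _.
  by apply: card_le_trans BB _; exact: subset_card_le.
have [h hAB hinj] := card_le_inj x0 leB.
pose C := h @` B; pose D := B `|` C.
have CB : C #<= B by exact: card_image_le.
have BC : B #<= C by apply: (inj_le_card _ hinj) => x Bx; exists x.
have DB : D #<= B by apply: card_le_setU => //; exact: card_lexx.
have CnB x : C x -> ~ B x by move=> [y /hAB[]] _ + <-.
(* the new pairs fit in C because D, hence its square, is no larger than B *)
have /(card_le_inj x0)[g gC ginj] : (D `*` D) `\` (B `*` B) #<= C.
  apply: card_le_trans BC; apply: card_le_trans BB.
  by apply: card_le_trans (card_leX DB DB); exact: card_le_setD.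
pose f' z := if `[< (B `*` B) z >] then f z else g z.
have f'B z : (B `*` B) z -> f' z = f z by rewrite /f' => /asboolT->.
have f'D z : ~ (B `*` B) z -> f' z = g z by rewrite /f' => /asboolF->.
have good' : good (D, f').
  split=> /=.
  - by move=> x [/BA//|[y /hAB[Ay _] <-]].
  - by apply: (sub_infinite_set _ Binf) => x; left.
  - move=> z Dz; have [Bz|nBz] := pselect ((B `*` B) z).
      by rewrite f'B//; left; exact: fB.
    by rewrite f'D//; right; exact: gC.
  - move=> y z /set_mem Dy /set_mem Dz.
    have [By|nBy] := pselect ((B `*` B) y);
      have [Bz|nBz] := pselect ((B `*` B) z).
    + by rewrite !f'B//; apply: finj; rewrite inE.
    + rewrite f'B// f'D// => fg.
      by case: (CnB (g z)); [exact: gC|rewrite -fg; exact: fB].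
    + rewrite f'D// f'B// => gf.
      by case: (CnB (g y)); [exact: gC|rewrite gf; exact: fB].
    + by rewrite !f'D//; apply: ginj; rewrite inE.
have /asboolP[/= DsubB _] : R (exist _ _ good') (exist _ _ goodB).
  apply: Bmax; apply/asboolP; split=> /=; first by move=> x; left.
  by move=> z /f'B.
have [b Bb] := infinite_setN0 Binf.
have Chb : C (h b) by exists b.
by case: (CnB _ Chb); apply: DsubB; right.
Qed.

(** * The dominating number *)

Lemma dfrak_infinite : infinite_set dfrak.
Proof.
move=> /finite_seqP[s ds]; have [dom _] := dfrakP.
have [g dg [N _ /(_ N (leqnn N))/=]] :=
  dom (fun n => (\max_(g <- s) (g : baire) n).+1).
have gs : g \in s by move: dg; rewrite ds.
rewrite ltnNge => /negP; apply.
exact: (@leq_bigmax_seq _ s predT (fun g : baire => g N)).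
Qed.

Lemma dfrak_square : dfrak `*` dfrak #<= dfrak.
Proof. exact: card_le_square dfrak_infinite. Qed.

Lemma countable_le_dfrak (T : Type) (A : set T) : countable A -> A #<= dfrak.
Proof. by move=> cA; exact: countable_le_infinite dfrak_infinite. Qed.

(** Adding all constants to a dominating family absorbs the finitely many
    exceptions allowed by [le_star]. *)
Lemma everywhere_dominating_family :
  exists2 E : set (nat -> nat), E #<= dfrak &
    forall f : nat -> nat, exists2 g, E g & forall n, f n <= g n.
Proof.
exists (\bigcup_m (fun (g : baire) n => g n + m) @` dfrak).
  apply: card_le_bigcup dfrak_square _ _; first exact: countable_le_dfrak.
  by move=> m _; exact: card_image_le.
move=> f; have [dom _] := dfrakP; have [g dg [N _ fg]] := dom f.
exists (fun n => g n + \max_(k < N) f k).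
  by exists (\max_(k < N) f k) => //; exists g.
move=> n; have [Nn|nN] := leqP N n; first exact/(leq_trans (fg n Nn))/leq_addr.
apply: leq_trans (leq_addl _ _).
exact: (leq_bigmax (Ordinal nN) : f (Ordinal nN) <= _).
Qed.

(** * Upper bound for the cardinality *)

Section UpperBound.
Variable X : topologicalType.
Implicit Types A U V W : set X.

(** Monotonicity of the base lets a pointwise larger function prescribe a
    smaller neighbourhood of a whole set. *)
Lemma first_countable_decreasing_base : first_countable X ->
  forall x : X, exists N : nat -> set X,
    [/\ forall n, open (N n), forall n, N n x,
        forall m n, m <= n -> N n `<=` N m &
        forall U, nbhs x U -> exists n, N n `<=` U].
Proof.
move=> fcX x; have [B [cB Bx Bbase]] := fcX x.
have [V0 BV0 _] := Bbase setT filterT.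
have /pfcard_geP[B0|/surjfunPex[g Bg]] := cB; first by rewrite B0 in BV0.
have gx k : nbhs x (g k) by apply: Bx; rewrite Bg; exists k.
exists (fun n => \big[setI/setT]_(k < n.+1) (g k)°); split.
- move=> n; apply: big_ind => [||k _]; first exact: openT.
    by move=> *; exact: openI.
  exact: open_interior.
- move=> n; rewrite -(bigcap_mkord _ (fun k => (g k)°)) => k _; exact: gx.
- move=> m n mn; rewrite -!(bigcap_mkord _ (fun k => (g k)°)) => y Ny k /= km.
  by apply: Ny => /=; exact: leq_trans km _.
- move=> U /Bbase[V]; rewrite Bg => -[n _ <-] gU; exists n.
  rewrite -(bigcap_mkord _ (fun k => (g k)°)) => y /(_ n (ltnSn n)).
  by move=> /interior_subset/gU.
Qed.

(** The character of [A] in [X], the least size of an outer base, is at most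
    [dfrak]. *)
Definition small_character A := exists F : set (set X),
  [/\ F #<= dfrak, forall U, F U -> open U /\ A `<=` U &
      forall V, open V -> A `<=` V -> exists2 U, F U & U `<=` V].

(** With decreasing countable bases at the points of [A], a neighbourhood of
    [A] is prescribed by a function from [nat] to [nat], and a larger function
    prescribes a smaller neighbourhood; so a dominating family suffices. *)
Lemma countable_small_character A :
  first_countable X -> countable A -> small_character A.
Proof.
move=> /first_countable_decreasing_base/choice[N NP] /countable_injP[e einj].
have [E Ed Edom] := everywhere_dominating_family.
pose W (g : nat -> nat) := \bigcup_(x in A) N x (g (e x)).
exists (W @` E); split; first exact: card_le_trans (card_image_le _ _) Ed.
  move=> _ [g _ <-]; split.
    by apply: bigcup_open => x _; case: (NP x).
  by move=> x Ax; exists x => //; case: (NP x).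
move=> V oV AV.
have /choice[f fP] : forall n, exists m, forall x, A x -> e x = n -> N x m `<=` V.
  (* at most one point of A is numbered n *)
  move=> n; have [[x [Ax exn]]|nx] := pselect (exists x, A x /\ e x = n).
    have [_ _ _ Nbase] := NP x.
    have [|m Nm] := Nbase V; first by apply: open_nbhs_nbhs; split=> //; exact: AV.
    exists m => y Ay eyn; suff -> : y = x by [].
    by apply: einj; rewrite ?inE// eyn.
  by exists 0 => x Ax exn; case: nx; exists x.
have [g Eg fg] := Edom f; exists (W g); first by exists g.
move=> y [x Ax Ny]; apply: (fP (e x) x) => //.
by case: (NP x) => _ _ + _; apply; first exact: fg.
Qed.

(** The complement of [A] and neighbourhoods meeting [A] in at most one point
    cover [X]. *)
Lemma Lindelof_discrete_countable A : Lindelof X -> closed A ->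
  A `<=` isolated A -> countable A.
Proof.
move=> LX cA dA.
pose C := [set U | open U /\ (U `&` A) #<= [set: unit]].
have [||C' [C'C cC' C'T]] := LX C; first by move=> U [].
  apply/seteqP; split=> // x _; have [Ax|nAx] := pselect (A x); last first.
    exists (~` A) => //; split; first exact: closed_openC.
    by rewrite setICl card_ge0.
  have [_ [V Vx VA]] := dA _ Ax; exists V°; last exact: Vx.
  split; first exact: open_interior.
  apply: (@card_le_trans _ _ _ [set x]).
    by rewrite -VA; apply: subset_card_le => y [/interior_subset].
  by apply: (@inj_le_card _ _ _ _ (fun=> tt)) => // y z /set_mem-> /set_mem->.
have -> : A = \bigcup_(U in C') (U `&` A).
  rewrite -setI_bigcupl C'T setTI //.
apply: bigcup_countable => // U /C'C[_ /sub_countable]; apply.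
exact: countableP.
Qed.

Lemma closed_derived A : closed A -> closed (derived A).
Proof.
move=> cA x clx; split.
  by apply: cA => U /clx[y [[Ay _] Uy]]; exists y.
move=> [Ax [V Vx VA]].
have [y [[Ay nIy] Vy]] := clx _ (nbhs_interior Vx).
apply: nIy; have /= Ey : [set x] y.
  by rewrite -VA; split=> //; exact: interior_subset.
by rewrite Ey; split=> //; exists V.
Qed.

(** Outside a neighbourhood [U] of its derived set, [A] is closed and
    discrete. *)
Lemma derived_nbhs_countable A U : Lindelof X -> closed A ->
  open U -> derived A `<=` U -> countable (A `\` U).
Proof.
move=> LX cA oU AU; apply: Lindelof_discrete_countable => //.
  by rewrite setDE; apply: closedI => //; exact: open_closedC.
move=> x [Ax nUx]; have [_ [V Vx VA]] : isolated A x.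
  by apply: contrapT => nI; apply/nUx/AU.
split; first by rewrite inE.
exists V => //; apply/seteqP; split=> [y [Vy [Ay _]]|_ ->].
  by rewrite -VA.
by split=> //; exact: nbhs_singleton.
Qed.

(** A neighbourhood of [A] is a neighbourhood [U] of its derived set together
    with a neighbourhood of the countable set [A `\` U] left out by [U]. *)
Lemma small_character_derived A : first_countable X -> Lindelof X ->
  closed A -> small_character (derived A) -> small_character A.
Proof.
move=> fcX LX cA [F [Fd FP Fbase]].
have /choice[G GP] : forall U, exists G : set (set X), F U ->
    [/\ G #<= dfrak, forall W, G W -> open W /\ A `\` U `<=` W &
      forall V, open V -> A `\` U `<=` V -> exists2 W, G W & W `<=` V].
  move=> U; have [FU|nF] := pselect (F U); last by exists set0.
  have [oU AU] := FP _ FU.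
  have [G GP] := countable_small_character fcX (derived_nbhs_countable LX cA oU AU).
  by exists G.
exists (\bigcup_(U in F) ((fun W => U `|` W) @` G U)); split.
- apply: card_le_bigcup dfrak_square Fd _ => U /GP[Gd _ _].
  exact: card_le_trans (card_image_le _ _) Gd.
- move=> _ [U FU [W GW <-]]; have [oU _] := FP _ FU.
  have [_ /(_ _ GW)[oW AW] _] := GP _ FU; split; first exact: openU.
  move=> x Ax; have [Ux|nUx] := pselect (U x); [by left|right].
  exact: AW.
- move=> V oV AV.
  have [|U FU UV] := Fbase V oV; first by move=> x [/AV].
  have [_ _ /(_ V oV)[|W GW WV]] := GP _ FU; first by move=> x [/AV].
  exists (U `|` W); first by exists U => //; exists W.
  by move=> x [/UV|/WV].
Qed.

(** Every isolated point of [A] is left out by some member of an outer base of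
    the derived set, each of which leaves out countably many points. *)
Lemma card_isolated_le_dfrak A : (forall x : X, closed [set x]) ->
  Lindelof X -> closed A -> small_character (derived A) ->
  isolated A #<= dfrak.
Proof.
move=> T1 LX cA [F [Fd FP Fbase]].
apply: (@card_le_trans _ _ _ (\bigcup_(U in F) (A `\` U))); last first.
  apply: card_le_bigcup dfrak_square Fd _ => U /FP[oU AU].
  exact/countable_le_dfrak/derived_nbhs_countable.
apply: subset_card_le => x Ix.
have [||U FU Ux] := Fbase (~` [set x]).
- exact: closed_openC.
- by move=> y [_ nIy] /= yx; apply: nIy; rewrite yx.
- exists U => //; split; first exact: isolatedS.
  by move=> /Ux; apply.
Qed.

Lemma closed_iter_derived n : closed (iter_derived n : set X).
Proof. by elim: n => [|n IHn]; [exact: closedT|exact: closed_derived]. Qed.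

(** Induction from the last, empty derived set back to [X]: a bound on the
    character of one derived set bounds the number of isolated points of the
    preceding one. *)
Lemma card_finite_height_le_dfrak n : FLS X -> has_scattered_height X n ->
  [set: X] #<= dfrak.
Proof.
move=> [/hausdorff_accessible/accessible_closed_set1 T1 fcX LX _] [hn _].
pose D k : set X := iter_derived k.
suff H k : k <= n -> small_character (D (n - k)) /\ D (n - k) #<= dfrak.
  by have [_] := H n (leqnn n); rewrite subnn.
elim: k => [_|k IHk kn].
  rewrite subn0 /D hn; split; last exact: card_ge0.
  by apply: countable_small_character => //; exact: countable0.
have [] := IHk (ltnW kn); rewrite -(subnSK kn).
set A := D (n - k.+1) => chA' A'd.
have cA : closed A by exact: closed_iter_derived.
split; first exact: small_character_derived.
rewrite -[A](setDUK (@isolatedS _ A)); apply: card_le_setU A'd.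
- exact: dfrak_infinite.
- exact: dfrak_square.
- exact: card_isolated_le_dfrak.
Qed.

End UpperBound.

(** * Compact sets of branches *)

Definition bounded_branches (g : seq nat -> nat) : set baire :=
  [set h | forall n, h n < g (mkseq h n)].

(** The tree of the sequences [s] whose entries are bounded by [g] along the way
    is finitely branching, so its levels are finite and bound each coordinate of
    its branches. *)
Lemma bounded_branches_sub_compact (g : seq nat -> nat) :
  exists2 Q : set baire, compact Q & bounded_branches g `<=` Q.
Proof.
pose level := fix level n : seq (seq nat) := if n is m.+1 then
  flatten [seq [seq rcons s k | k <- iota 0 (g s)] | s <- level m] else [:: [::]].
pose b n := \max_(s <- level n) g s.
exists [set h : baire | forall n, `I_(b n) (h n)].
  apply: (@tychonoff nat (fun=> nat) (fun n => `I_(b n))) => n.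
  exact/finite_compact/finite_II.
move=> h hg n /=; have hlevel : mkseq h n \in level n.
  elim: n => [|n IHn] //; apply/flatten_mapP; exists (mkseq h n) => //.
  rewrite -[mkseq h n.+1]/(map h (iota 0 n.+1)) -addn1 iotaD map_cat /= cats1.
  by apply/mapP; exists (h n) => //; rewrite mem_iota add0n hg.
by apply: leq_trans (@leq_bigmax_seq _ _ xpredT g _ hlevel isT); exact: hg.
Qed.

(** * Spaces of nodes and branches *)

(** The points with a label are the nodes, named by their label; a point [x]
    without label stands for the branch [f x]. This is a copy of [K], indexed by
    [lab] and [f] because they determine its topology. *)
Definition node_space (K : choiceType) (lab : K -> option (seq nat))
  (f : K -> baire) : Type := K.

Section NodeSpace.
Variables (K : choiceType) (lab : K -> option (seq nat)) (f : K -> baire).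
Local Notation X := (node_space lab f).

HB.instance Definition _ := Choice.on X.

Definition tail (s : seq nat) (k : nat) : set K :=
  [set y | [/\ lab y = None, mkseq (f y) (size s) = s & k <= f y (size s)]].

Definition node_open (U : set K) : Prop :=
  forall x s, U x -> lab x = Some s -> exists k, tail s k `<=` U.

Lemma tailS s k k' : k <= k' -> tail s k' `<=` tail s k.
Proof. by move=> kk' y [? ?] /(leq_trans kk'). Qed.

Lemma node_openT : node_open setT.
Proof. by move=> x s _ _; exists 0. Qed.

Lemma node_openI : setI_closed node_open.
Proof.
move=> U V oU oV x s [Ux Vx] xs.
have [k kU] := oU _ _ Ux xs; have [l lV] := oV _ _ Vx xs.
exists (maxn k l) => y ty; split; [apply: kU|apply: lV].
  exact: tailS (leq_maxl _ _) _ ty.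
exact: tailS (leq_maxr _ _) _ ty.
Qed.

Lemma node_open_bigU (I : Type) (U : I -> set K) :
  (forall i, node_open (U i)) -> node_open (\bigcup_i U i).
Proof.
move=> oU x s [i _ Ux] xs; have [k kU] := oU i _ _ Ux xs.
by exists k => y /kU; exists i.
Qed.

HB.instance Definition _ :=
  isOpenTopological.Build X node_openT node_openI node_open_bigU.

Definition node_nbhs (x : X) (k : nat) : set X :=
  [set y | y = x \/ exists2 s, lab x = Some s & tail s k y].

Lemma node_nbhsx x k : node_nbhs x k x. Proof. by left. Qed.

Lemma node_nbhs_unlabelled x k : lab x = None -> node_nbhs x k = [set x].
Proof.
move=> xN; apply/seteqP; split=> [y [->//|[s]]|y ->]; last exact: node_nbhsx.
by rewrite xN.
Qed.

Lemma open_node_nbhs x k : open (node_nbhs x k : set X).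
Proof.
move=> y t [->|[s xs [yN _ _]]] yt; last by rewrite yN in yt.
by exists k => z tz; right; exists t.
Qed.

Lemma node_nbhs_base x (U : set X) :
  nbhs x U -> exists k, node_nbhs x k `<=` U.
Proof.
move=> [V [oV Vx VU]]; case xs : (lab x) => [s|]; last first.
  by exists 0; rewrite node_nbhs_unlabelled // => _ ->; exact: VU.
have [k kV] := oV _ _ Vx xs; exists k => y [->|[t]]; first exact: VU.
by rewrite xs => -[<-] /kV/VU.
Qed.

Lemma nbhs_node_nbhs x k : nbhs (x : X) (node_nbhs x k).
Proof.
by apply: open_nbhs_nbhs; split; [exact: open_node_nbhs|exact: node_nbhsx].
Qed.

Lemma first_countable_node_space : first_countable X.
Proof.
move=> x; exists (range (node_nbhs x)); split.
- exact: card_image_le.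
- by move=> _ [k _ <-]; exact: nbhs_node_nbhs.
- by move=> U /node_nbhs_base[k kU]; exists (node_nbhs x k) => //; exists k.
Qed.

(** Tails contain no node. *)
Lemma isolated_labelled (A : set X) x : A x ->
  (forall y, A y -> lab y != None) -> isolated A x.
Proof.
move=> Ax Alab; split; first by rewrite inE.
exists (node_nbhs x 0); first exact: nbhs_node_nbhs.
apply/seteqP; split=> [y [[//|[s _ [yN _ _]]] /Alab]|_ ->].
  by rewrite yN.
by split=> //; exact: node_nbhsx.
Qed.

Lemma isolated_unlabelled (A : set X) x : A x -> lab x = None -> isolated A x.
Proof.
move=> Ax xN; split; first by rewrite inE.
exists (node_nbhs x 0); first exact: nbhs_node_nbhs.
by rewrite node_nbhs_unlabelled//; apply/setIidPl => _ ->.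
Qed.

Lemma scattered_node_space : scattered X.
Proof.
move=> A [x Ax]; have [[y [Ay yN]]|nN] := pselect (exists y, A y /\ lab y = None).
  by exists y; exact: isolated_unlabelled.
exists x; apply: isolated_labelled => // y Ay.
by apply/eqP => yN; apply: nN; exists y.
Qed.

Lemma node_space_height : exists n, has_scattered_height X n.
Proof.
have h2 : iter_derived 2 = set0 :> set X.
  apply/seteqP; split=> // x [Dx]; apply; apply: isolated_labelled => //.
  move=> y [_ nIy]; apply/eqP => yN.
  by apply: nIy; exact: isolated_unlabelled.
have exP : exists n, `[< iter_derived n = set0 :> set X >].
  by exists 2; apply/asboolP.
exists (ex_minn exP); case: ex_minnP => n /asboolP hn nmin.
by split=> // m /asboolP; exact: nmin.
Qed.

Hypothesis lab_inj : forall x y s, lab x = Some s -> lab y = Some s -> x = y.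

(** Of two nodes on a common branch, one extends the other, say [t] extends [s].
    The branch then leaves [s] along the entry of [t] in position [size s], so it
    is not in a tail of [s] beyond this entry. The bound adds to this entry its
    analogue for [s] extending [t], so that one bound serves both cases. *)
Lemma tail_disjoint s t z : s <> t ->
  tail s (nth 0 t (size s) + nth 0 s (size t)).+1 z ->
  ~ tail t (nth 0 t (size s) + nth 0 s (size t)).+1 z.
Proof.
move=> st [_ sz sk] [_ tz tk]; have [lt_st|lt_ts|eq_st] := ltngtP (size s) (size t).
- move: sk; rewrite -[in nth 0 t _]tz nth_mkseq //.
  by rewrite ltnNge leq_addr.
- move: tk; rewrite -[in nth 0 s _]sz nth_mkseq //.
  by rewrite ltnNge leq_addl.
- by apply: st; rewrite -sz -tz eq_st.
Qed.

Lemma node_nbhs_disjoint (x y : X) : x <> y -> exists k,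
  node_nbhs x k `&` node_nbhs y k = set0.
Proof.
move=> xy; case xs : (lab x) => [s|]; case yt : (lab y) => [t|].
- exists (nth 0 t (size s) + nth 0 s (size t)).+1.
  apply/seteqP; split=> // z [[->|[s' + zs]] [|[t' + zt]]] //.
  + by case: zt => xN _ _; rewrite xN in xs.
  + by move=> _ zy; rewrite zy in zs; case: zs; rewrite yt.
  + rewrite xs yt => -[ss'] [tt']; rewrite -ss' in zs; rewrite -tt' in zt.
    apply: tail_disjoint zs zt => st; apply: xy; apply: lab_inj xs _.
    by rewrite st.
- exists (f y (size s)).+1; rewrite (node_nbhs_unlabelled _ yt).
  apply/seteqP; split=> // z [+ zy]; rewrite zy => -[/esym//|[s']].
  by rewrite xs => -[<-] [_ _]; rewrite ltnn.
- exists (f x (size t)).+1; rewrite (node_nbhs_unlabelled _ xs).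
  apply/seteqP; split=> // z [zx]; rewrite zx => -[//|[t']].
  by rewrite yt => -[<-] [_ _]; rewrite ltnn.
- exists 0; rewrite !node_nbhs_unlabelled//.
  by apply/seteqP; split=> // z [-> ].
Qed.

Lemma hausdorff_node_space : hausdorff_space X.
Proof.
rewrite open_hausdorff => x y /eqP/node_nbhs_disjoint[k kxy].
exists (node_nbhs x k, node_nbhs y k); rewrite /= ?inE.
  by split; exact: node_nbhsx.
by split=> //; exact: open_node_nbhs.
Qed.

Hypothesis lab_onto : forall y s, lab y = None -> exists x, lab x = Some s.
Hypothesis f_Lusin : forall Q, compact Q -> countable (f @^-1` Q).

(** Choose a member [U x] of the cover around each node [x], and let [g] bound
    the branches leaving the node outside [U x]. A point left uncovered has a
    branch bounded by [g] at all its nodes, so it lies in the preimage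
    under [f] of a compact set, which is countable. *)
Lemma Lindelof_node_space : Lindelof X.
Proof.
move=> C oC covC.
have /choice[U UP] : forall x, exists V, C V /\ V x.
  by move=> x; have : [set: X] x by []; rewrite -covC => -[V]; exists V.
pose L : set X := [set x | lab x != None].
have cL : countable L.
  apply: card_le_trans (countableP [set: option (seq nat)]).
  apply: (@inj_le_card _ _ _ _ lab) => // x y /set_mem Lx _ xy.
  move: Lx; rewrite /L /=; case xs : (lab x) => [s|//] _.
  by apply: (lab_inj xs); rewrite -xy.
have /choice[g gP] : forall s, exists k, forall x, lab x = Some s ->
    tail s k `<=` U x.
  move=> s; have [[x xs]|nx] := pselect (exists x, lab x = Some s).
    have [CU Ux] := UP x; have [k kU] := oC _ CU _ _ Ux xs.
    by exists k => y ys; rewrite (lab_inj ys xs).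
  by exists 0 => x xs; case: nx; exists x.
have [Q cQ gQ] := bounded_branches_sub_compact g.
exists (U @` (L `|` f @^-1` Q)); split.
- by move=> _ [x _ <-]; case: (UP x).
- apply: card_le_trans (card_image_le _ _) _.
  have -> : L `|` f @^-1` Q = \bigcup_b (if b then L else f @^-1` Q).
    apply/seteqP; split=> x; first by case=> ?; [exists true|exists false].
    by case=> -[] _; [left|right].
  by apply: bigcup_countable => // -[] _ //; exact: f_Lusin.
- apply/seteqP; split=> // y _.
  have self z : (L `|` f @^-1` Q) z -> z = y ->
      (\bigcup_(V in U @` (L `|` f @^-1` Q)) V) y.
    move=> Lz <-; exists (U z); last by case: (UP z).
    by exists z.
  have [yL|/negP/negPn/eqP yN] := pselect (L y); first by apply: (self y) => //; left.
  have [/gQ Qy|/existsNP[n /negP]] := pselect (bounded_branches g (f y)).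
    by apply: (self y) => //; right.
  rewrite -leqNgt => gn; have [x xs] := lab_onto (mkseq (f y) n) yN.
  exists (U x); first by exists x => //; left; rewrite /L /= xs.
  by apply: gP xs _ _; split; rewrite ?size_mkseq.
Qed.

Lemma FLS_node_space : FLS X.
Proof.
split; [exact: hausdorff_node_space|exact: first_countable_node_space|
  exact: Lindelof_node_space|exact: scattered_node_space].
Qed.

End NodeSpace.

(** The topology is put on [K] itself, so that no cardinality has to be
    computed. If [K] is countable, all points are nodes and the space is
    discrete. *)
Lemma FLS_of_card_le_dfrak (L : set baire) (K : Type) :
  K_Lusin L -> L #= dfrak -> [set: K] #<= dfrak ->
  exists (X : topologicalType) (n : nat),
    [/\ FLS X, has_scattered_height X n & [set: X] #= [set: K]].
Proof.
move=> LL Ld Kd; pose KC : choiceType := {classic K}.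
suff [lab [f [lab_inj lab_onto f_Lusin]]] :
    exists (lab : KC -> option (seq nat)) (f : KC -> baire),
    [/\ forall x y s, lab x = Some s -> lab y = Some s -> x = y,
        forall y s, lab y = None -> exists x, lab x = Some s &
        forall Q, compact Q -> countable (f @^-1` Q)].
  have [n hn] := node_space_height lab f.
  by exists (node_space lab f), n; split=> //; exact: FLS_node_space.
have [cK|ncK] := pselect (countable [set: K]).
  have /countable_injP[c cinj] := cK.
  exists (fun x => Some [:: c x]), (fun _ _ => 0); split=> //.
    by move=> x y s [<-] [cxy]; apply: cinj; rewrite ?inE.
  by move=> Q _; apply: sub_countable cK; exact: card_leT.
have Kinf : infinite_set [set: K] by move=> /finite_set_countable.
have [x0 _] := infinite_setN0 Kinf.
have /infiniteP/(card_le_inj x0)[e _ einj] := Kinf.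
have ej (s t : seq nat) : e (pickle s) = e (pickle t) -> s = t.
  by move=> st; apply: (pcan_inj pickleK); apply: einj; rewrite ?inE.
have /(card_le_inj (fun=> 0))[f fL finj] : [set: K] #<= L.
  by have /card_eqPle[_] := Ld; exact: card_le_trans Kd.
have /choice[lab labP] : forall x, exists o : option (seq nat),
    forall s, o = Some s <-> e (pickle s) = x.
  move=> x; have [[s <-]|nx] := pselect (exists s : seq nat, e (pickle s) = x).
    by exists (Some s) => t; split=> [[->]|/ej->].
  by exists None => s; split=> // sx; case: nx; exists s.
exists lab, f; split.
- by move=> x y s /labP <- /labP.
- by move=> y s _; exists (e (pickle s)); apply/labP.
- move=> Q /LL; apply: card_le_trans; apply: (@inj_le_card _ _ _ _ f) => //.
    by move=> x Qx; split=> //; exact: fL.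
  by move=> x y _ _; apply: finj; rewrite inE.
Qed.

Theorem corollary6p5 :
  (exists L : set baire, K_Lusin L /\ L #= dfrak) ->
  forall kappa : Type,
    (exists (X : topologicalType) (n : nat),
       [/\ FLS X, has_scattered_height X n & [set: X] #= [set: kappa]])
    <-> [set: kappa] #<= dfrak.
Proof.
move=> [L [LL Ld]] kappa; split; last exact: FLS_of_card_le_dfrak Ld.
move=> [X [n [flsX hn /card_eqPle[_ leX]]]].
exact: card_le_trans leX (card_finite_height_le_dfrak flsX hn).
Qed.
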